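(* Let $C$ be a non-Frobenius $i$-collision over $\mathbb{F}_q$ with $i\ge 2$ at degree $p^2$, and let $f$ be the common composition $g\circ h$ of the pairs $(g,h)\in C$. There is an integer $k$ with $1\le k<p$ and the following properties for all $(g,h)\in C$. (i) $\deg_2(g)=\deg_2(h)=k$. (ii) For all $(g^*,h^* )\in C$ with $(g,h)\ne(g^*,h^* )$, we have $g_k\ne g_k^*$ and $h_k\ne h_k^*$. (iii) Set $a=-f_{kp}$ and $b=k^{-1}f_{kp-p+k}$. Then $bh_k\ne 0$, and $$h_k^{p+1}+ah_k+b=0,\qquad g_k=-a-h_k^p=bh_k^{-1}.$$ (iv) $i\le p+1$.
   Context: $\mathbb{F}_q$ is a finite field of characteristic $p$. All polynomials $f,g,h$ are in $\mathbb{F}_q[x]$, monic and original (vanishing at $0$). An $i$-collision at degree $p^2$ is a set of $i$ distinct pairs $(g,h)$ with $\deg g=\deg h=p$, all with the same composition $f=g\circ h$ (of degree $p^2$). A Frobenius collision is a $2$-collision $\{(x^p,h),(\sigma_p(h),x^p)\}$ with $\deg h=p$, $h\ne x^p$, where $\sigma_p$ raises each coefficient to the $p$th power; non-Frobenius means not of this form. For a polynomial $v$, $v_j$ denotes the coefficient of $x^j$, and the second-degree is $\deg_2 v=\deg(v-\mathrm{lc}(v)x^{\deg v})$, where $\mathrm{lc}$ is the leading coefficient, with $\deg_2v=-\infty$ for monomials and zero. *)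

(* Defs.v *)
From HB Require Import structures.
From mathcomp Require Import all_boot all_order all_algebra.
From mathcomp Require Import finmap.

Set Implicit Arguments.
Unset Strict Implicit.
Unset Printing Implicit Defensive.

Import GRing.Theory.
Local Open Scope ring_scope.

Section Collisions.
Variable F : finFieldType.
Implicit Types (f g h v : {poly F}) (C : {fset {poly F} * {poly F}}).

Definition original v : Prop := v`_0 = 0.

(* Since size v = deg v + 1, this includes that v is nonzero. *)
Definition monic_original_deg (d : nat) v : Prop :=
  [/\ v \is monic, original v & size v = d.+1].

(* None stands for the degree -oo of the zero polynomial. *)
Definition degree v : option nat :=
  if v == 0 then None else Some (size v).-1.

Definition deg2 v : option nat :=
  degree (v - lead_coef v *: 'X^((size v).-1)).

Definition is_collision (p i : nat) C f : Prop :=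
  #|` C| = i /\
  forall g h, (g, h) \in C ->
    [/\ monic_original_deg p g, monic_original_deg p h & g \Po h = f].

Definition sigma (p : nat) h : {poly F} := map_poly (fun c : F => c ^+ p) h.

Definition is_frobenius_collision (p : nat) C : Prop :=
  exists h, [/\ monic_original_deg p h, h <> 'X^p &
    C = [fset ('X^p, h); (sigma p h, 'X^p)]%fset].

End Collisions.

(* Main.v *)
(* If [f = g o h] then [f' = g'(h) h'], since [x^p] has derivative zero. When
   [f' = 0], each pair has [g = x^p] or [h = x^p], and the collision is
   Frobenius. Otherwise [deg f' = (deg2 g - 1) p + (deg2 h - 1)] with both
   second-degrees in [1, p), so they are the same [l] and [m] for all pairs.
   Comparing degrees in [g o h - g' o h' = 0] gives
   [deg (g - g') = deg (h - h') = l], hence [l <= m]; if [l < m] then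
   [h_m = h'_m], and the leading coefficient [l m g_l h_m] of [f'] forces
   [g_l = g'_l], a contradiction. So [l = m = k], [f_{kp} = g_k + h_k^p] and
   [f_{kp-p+k} = k g_k h_k]; the [h_k] are distinct roots of
   [x^{p+1} + a x + b]. *)
Require Import Defs.
From HB Require Import structures.
From mathcomp Require Import all_boot all_order all_algebra.
From mathcomp Require Import finmap.
From mathcomp Require Import zify ring.

Set Implicit Arguments.
Unset Strict Implicit.
Unset Printing Implicit Defensive.

Import GRing.Theory.
Local Open Scope ring_scope.

(** * Degrees of compositions and of their differences *)

Lemma size_eqS (R : nzRingType) (P : {poly R}) (n : nat) :
  (size P <= n.+1)%N -> P`_n != 0 -> size P = n.+1.
Proof.
move=> sP Pn; apply/eqP; rewrite eqn_leq sP ltnNge.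
by apply: contra Pn => /leq_sizeP/(_ n (leqnn n)) ->.
Qed.

Lemma size_comp_polyS (R : idomainType) (P u : {poly R}) (n : nat) :
  (1 < size u)%N -> size P = n.+1 -> size (P \Po u) = (n * (size u).-1).+1.
Proof.
move=> su sP; have := size_comp_poly P u; rewrite sP /= => <-.
rewrite prednK // size_poly_gt0 -lead_coef_eq0 lead_coef_comp //.
have P_neq0 : P != 0 by rewrite -size_poly_gt0 sP.
have u_neq0 : u != 0 by rewrite -size_poly_gt0 ltnW.
by rewrite mulf_neq0 ?expf_neq0 ?lead_coef_eq0.
Qed.

(** Factor [u ^+ i - v ^+ i] as [(u - v) * Q i]. As [u] and [v] are monic, [Q i] has degree at most
    [(i - 1) * n], and only the top index [i = l.+1] reaches degree [l * n], with coefficient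
    [l.+1], which is invertible. *)
Lemma size_sub_comp (R : idomainType) (G u v : {poly R}) (l n : nat) :
    size G = l.+2 -> l.+1%:R != 0 :> R ->
    u \is monic -> v \is monic -> size u = n.+1 -> size v = n.+1 -> u != v ->
  size ((G \Po u) - (G \Po v))%R = (l * n + size (u - v)%R)%N.
Proof.
move=> sG l_nz mu mv su sv neq_uv.
pose Q i := \sum_(j < i) u ^+ (i.-1 - j) * v ^+ j.
have sM i j : size (u ^+ i * v ^+ j) = ((i + j) * n).+1 /\
    lead_coef (u ^+ i * v ^+ j) = 1.
  split; last by apply/monicP; rewrite monicMl monic_exp.
  rewrite size_monicM ?monic_exp ?monic_neq0 ?monic_exp //.
  have := size_exp u i; have := size_exp v j; rewrite su sv /=.
  have : (0 < size (u ^+ i))%N by rewrite size_poly_gt0 monic_neq0 ?monic_exp.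
  have : (0 < size (v ^+ j))%N by rewrite size_poly_gt0 monic_neq0 ?monic_exp.
  by case: (size _) => // s _; case: (size _) => //= s' _ -> ->; lia.
have sQ i : (size (Q i) <= (i.-1 * n).+1)%N.
  apply: leq_trans (size_sum _ _ _) _; apply/bigmax_leqP => j _.
  by rewrite (sM _ _).1 subnK //; have := ltn_ord j; lia.
(* Each of the [l.+1] summands is monic of degree [l * n]. *)
have QlE : (Q l.+1)`_(l * n) = l.+1%:R.
  rewrite coef_sum (eq_bigr (fun=> 1)) ?sumr_const ?card_ord // => j _.
  have [sj] := sM (l.+1.-1 - j)%N j.
  by rewrite lead_coefE sj subnK //=; have := ltn_ord j; lia.
have -> : (G \Po u) - (G \Po v) = (u - v) * \sum_(i < l.+2) G`_i *: Q i.
  rewrite !comp_polyE sG -sumrB mulr_sumr; apply: eq_bigr => i _.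
  by rewrite -scalerBr subrXX scalerAr.
set S := \sum_(i < _) _.
have sS : size S = (l * n).+1.
  (* If [n = 0], monic [u] and [v] are both the constant 1, against [u != v]. The strict degree
     comparison below needs [n] positive. *)
  case: n su sv sM sQ QlE => [|n] su sv sM sQ QlE.
    move/eqP: neq_uv; case; move: mu mv; rewrite !monicE !lead_coefE su sv.
    by rewrite [u]size1_polyC ?su // [v]size1_polyC ?sv //
      !coefC => /eqP-> /eqP->.
  apply: size_eqS.
    apply: leq_trans (size_sum _ _ _) _; apply/bigmax_leqP => i _.
    apply: leq_trans (size_scale_leq _ _) _; apply: leq_trans (sQ i) _.
    by rewrite ltnS leq_mul2r; have := ltn_ord i; lia.
  rewrite coef_sum big_ord_recr /= big1 => [|i _]; last first.
    rewrite coefZ [(Q i)`_ _]nth_default ?mulr0 // /Q.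
    apply: leq_trans (size_sum _ _ _) _.
    apply/bigmax_leqP => j _; rewrite (sM _ _).1 subnK; last first.
      by have := ltn_ord j; lia.
    by rewrite ltn_pmul2r //; have := ltn_ord i; have := ltn_ord j; lia.
  rewrite add0r coefZ QlE mulf_neq0 //.
  have := lead_coef_eq0 G; rewrite lead_coefE sG /= => ->.
  by rewrite -size_poly_gt0 sG.
have uv0 : u - v != 0 by rewrite subr_eq0.
have S0 : S != 0 by rewrite -size_poly_gt0 sS.
by rewrite size_mul // sS addnS /= addnC.
Qed.

Lemma cardfs_gt1_neq (K : choiceType) (A : {fset K}) :
  (1 < #|` A|)%N -> exists x y, [/\ x \in A, y \in A & x != y].
Proof.
have memA z : (z \in A) = (z \in enum_fset A) by [].
have := fset_uniq A; move: (enum_fset A) memA.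
case=> [|x [|y s]] //= memA /andP[x_notin _] _.
exists x, y; rewrite !memA !inE !eqxx orbT; split=> //.
by apply: contra x_notin => /eqP ->; rewrite inE eqxx.
Qed.

(** * Characteristic [p]: the Frobenius map and derivatives *)

Section CollisionsCharP.
Variables (F : finFieldType) (p : nat).
Hypothesis charFp : p \in [pchar F].
Implicit Types f g h : {poly F}.

Let p_pr : prime p := pcharf_prime charFp.

Let natr_neq0 n : (0 < n < p)%N -> n%:R != 0 :> F.
Proof. by case/andP=> n_gt0 n_ltp; rewrite -(dvdn_pcharf charFp) gtnNdvd. Qed.

(** The [p]-th power is a ring morphism on [{poly F}], so both sides obey the same recursion along
    [h * 'X + c%:P]. *)
Lemma expXp_comp h : h ^+ p = sigma p h \Po 'X^p.
Proof.
have charPp : p \in [pchar {poly F}] by rewrite pchar_poly.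
rewrite -[sigma p h]/(map_poly (pFrobenius_aut charFp) h).
elim/poly_ind: h => [|h c IHh].
  by rewrite rmorph0 comp_poly0 expr0n gtn_eqF ?prime_gt0.
rewrite rmorphD rmorphM /= map_polyX map_polyC /= comp_polyD comp_polyM.
rewrite comp_polyX comp_polyC -IHh pFrobenius_autE polyC_exp.
by rewrite -!(pFrobenius_autE charPp) rmorphD rmorphM.
Qed.

Lemma expXpB h h' : (h - h') ^+ p = h ^+ p - h' ^+ p.
Proof.
have charPp : p \in [pchar {poly F}] by rewrite pchar_poly.
by rewrite -!(pFrobenius_autE charPp) rmorphB.
Qed.

Lemma coef_expXp h (j : nat) : (h ^+ p)`_(j * p) = h`_j ^+ p.
Proof.
rewrite expXp_comp coef_comp_poly_Xn ?prime_gt0 // dvdn_mull // mulnK ?prime_gt0 //.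
by rewrite coef_map_id0 // expr0n gtn_eqF ?prime_gt0.
Qed.

Lemma derivXp : ('X^p : {poly F})^`() = 0.
Proof. by rewrite derivXn -mulr_natl -polyC_natr (pcharf0 charFp) mul0r. Qed.

Lemma size_deriv_tame (P : {poly F}) (n : nat) :
  size P = n.+2 -> (n.+1 < p)%N -> size P^`() = n.+1.
Proof.
move=> sP n_ltp; have P_neq0 : P != 0 by rewrite -size_poly_gt0 sP.
apply: size_eqS; first by have := lt_size_deriv P_neq0; rewrite sP.
rewrite coef_deriv -mulr_natl mulf_neq0 ?natr_neq0 //.
by have := lead_coef_eq0 P; rewrite lead_coefE sP => ->.
Qed.

Lemma deriv_subXp g : g^`() = (g - 'X^p)^`().
Proof. by rewrite derivB derivXp subr0. Qed.

(** Subtracting ['X^p] strips the leading term of [g], so the second-degree of [g] becomes an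
    ordinary degree; [l.+2] encodes second-degree [l.+1], which is positive since a constant
    remainder would have derivative zero. *)
Lemma size_subXp g : monic_original_deg p g -> g^`() != 0 ->
  exists2 l, size (g - 'X^p) = l.+2 & (l.+1 < p)%N.
Proof.
move=> [mg og sg]; rewrite deriv_subXp => g'_neq0.
have G0 : (g - 'X^p)`_0 = 0.
  by rewrite coefB coefXn og; case: p p_pr => // *; rewrite subr0.
have sG : (size (g - 'X^p)%R <= p)%N.
  apply/leq_sizeP => j; rewrite leq_eqVlt => /predU1P[<-|lt_pj].
    move/monicP: mg; rewrite lead_coefE sg /= coefB coefXn eqxx => ->.
    by rewrite subrr.
  by rewrite coefB coefXn nth_default ?sg // gtn_eqF // subrr.
case sGE: (size _) sG => [|[|l]] sG; last by exists l.
  move/eqP: sGE; rewrite size_poly_eq0 => /eqP G_eq0.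
  by rewrite G_eq0 deriv0 eqxx in g'_neq0.
have /size1_polyC GE : (size (g - 'X^p)%R <= 1)%N by rewrite sGE.
by rewrite GE derivC eqxx in g'_neq0.
Qed.

Lemma coef_subXp g j : (j < p)%N -> (g - 'X^p)`_j = g`_j.
Proof. by move=> j_ltp; rewrite coefB coefXn ltn_eqF // subr0. Qed.

Lemma deg2_subXp g (l : nat) : monic_original_deg p g ->
  size (g - 'X^p) = l.+1 -> deg2 g = Some l.
Proof.
move=> [/monicP mg _ sg] sG; rewrite /deg2 mg sg scale1r /degree sG /=.
by rewrite -size_poly_eq0 sG.
Qed.

(** * A single decomposition, with second-degrees [l.+1] and [m.+1] *)

Section Decomposition.
Variables (f g h : {poly F}) (l m : nat).
Hypothesis dh : monic_original_deg p h.
Hypothesis fE : g \Po h = f.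
Hypotheses (sG : size (g - 'X^p) = l.+2) (l_ltp : (l.+1 < p)%N).
Hypotheses (sH : size (h - 'X^p) = m.+2) (m_ltp : (m.+1 < p)%N).

Let size_h : size h = p.+1. Proof. by case: dh. Qed.
Let h_gt1 : (1 < size h)%N. Proof. by rewrite size_h ltnS prime_gt0. Qed.

Lemma lead_subXp : lead_coef (g - 'X^p) = g`_l.+1.
Proof. by rewrite lead_coefE sG coef_subXp. Qed.

Lemma coef2_neq0 : g`_l.+1 != 0.
Proof. by rewrite -lead_subXp lead_coef_eq0 -size_poly_gt0 sG. Qed.

(** By the chain rule the degrees [l * p] and [m] add up. Since [m < p], they can be recovered from
    [f] alone as quotient and remainder modulo [p]. *)
Lemma size_deriv_decomp : size f^`() = (l * p + m).+1.
Proof.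
have sg' : size g^`() = l.+1 by rewrite deriv_subXp; apply: size_deriv_tame.
have sh' : size h^`() = m.+1 by rewrite deriv_subXp; apply: size_deriv_tame.
have sgh : size (g^`() \Po h) = (l * p).+1.
  by rewrite (size_comp_polyS h_gt1 sg') size_h.
rewrite -fE deriv_comp size_mul -?size_poly_gt0 ?sgh ?sh' //=.
by rewrite addnS.
Qed.

(** The leading coefficient of the derivative of [f] is computed directly and by the chain rule; the
    factor [m.+1] common to both results is then cancelled. *)
Lemma coef_deriv_decomp :
  f`_(l * p + m.+1) = l.+1%:R * g`_l.+1 * h`_m.+1.
Proof.
have sg' : size g^`() = l.+1 by rewrite deriv_subXp; apply: size_deriv_tame.
have sh' : size h^`() = m.+1 by rewrite deriv_subXp; apply: size_deriv_tame.
have := lead_coefE f^`(); rewrite size_deriv_decomp /= coef_deriv.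
rewrite -{1}fE deriv_comp lead_coefM lead_coef_comp // sg' /=.
have /monicP -> : h \is monic by case: dh.
rewrite expr1n mulr1 !lead_coefE sg' sh' /= !coef_deriv.
  rewrite -(mulr_natl _ l.+1) -(mulr_natl _ m.+1) -(mulr_natl _ (l * p + m).+1).
have -> : (l * p + m).+1%:R = m.+1%:R :> F.
  by rewrite -addnS natrD natrM (pcharf0 charFp) mulr0 add0r.
rewrite addnS => E; apply: (mulfI (natr_neq0 (n := m.+1) _)) => //.
by rewrite -E; ring.
Qed.

Lemma decomp_subXp : f = h ^+ p + ((g - 'X^p) \Po h).
Proof. by rewrite comp_polyB comp_Xn_poly fE addrC subrK. Qed.

(** At index [l.+1 * p], [h ^+ p] contributes by Frobenius and [(g - 'X^p) \Po h] contributes its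
    leading coefficient. *)
Lemma coef_lead_decomp : f`_(l.+1 * p) = h`_l.+1 ^+ p + g`_l.+1.
Proof.
rewrite decomp_subXp coefD coef_expXp; congr (_ + _).
have := lead_coef_comp (g - 'X^p) h_gt1.
have /monicP -> : h \is monic by case: dh.
rewrite expr1n mulr1 lead_subXp lead_coefE (size_comp_polyS h_gt1 sG).
by rewrite size_h.
Qed.

End Decomposition.

(* In [0 = (h - h')^p + (G - G') o h + (G' o h - G' o h')] the first two
   degrees are multiples of [p] and the third is not, so the first two terms
   dominate and have equal degrees. *)
Lemma size_sub_decomp f g h g' h' (l : nat) :
    monic_original_deg p h -> monic_original_deg p h' ->
    g \Po h = f -> g' \Po h' = f -> (g, h) != (g', h') ->
    size (g - 'X^p) = l.+2 -> size (g' - 'X^p) = l.+2 -> (l.+1 < p)%N ->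
  size (g - g') = l.+2 /\ size (h - h') = l.+2.
Proof.
move=> dh dh' fE fE' neq sG sG' l_ltp.
have [mh oh sh] := dh; have [mh' oh' sh'] := dh'.
have p_gt0 := prime_gt0 p_pr.
have h_gt1 : (1 < size h)%N by rewrite sh.
pose D := g - g'; pose d := h - h'.
(* If [h = h'], cancelling the nonconstant [h] on the right gives [g = g']. *)
have d_neq0 : d != 0.
  rewrite subr_eq0; apply: contra neq => /eqP hh'.
  rewrite xpair_eqE hh' eqxx andbT.
  by rewrite -subr_eq0 -(comp_poly_eq0 _ h_gt1) comp_polyB fE -fE' hh' subrr.
have [e se e_gt0] : exists2 e, size d = e.+1 & (0 < e)%N.
  case sd: (size d) => [|[|e]]; last by exists e.+1.
    by move/eqP: sd; rewrite size_poly_eq0 (negPf d_neq0).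
  have /size1_polyC dE : (size d <= 1)%N by rewrite sd.
  by move: d_neq0; rewrite dE coefB oh oh' subrr polyC0 eqxx.
have e_ltp : (e < p)%N.
  rewrite -se; apply/leq_sizeP => j; rewrite leq_eqVlt => /predU1P[<-|lt_pj].
    move/monicP: mh; move/monicP: mh'; rewrite !lead_coefE sh sh' /= coefB.
    by move=> -> ->; rewrite subrr.
  by rewrite coefB !nth_default ?sh ?sh' // subrr.
have sA : size (d ^+ p) = (e * p).+1.
  rewrite -(prednK (n := size (d ^+ p))) ?size_poly_gt0 ?expf_neq0 //.
  by rewrite size_exp se.
pose T := ((g' - 'X^p) \Po h) - ((g' - 'X^p) \Po h').
have sT : size T = (l * p + e.+1)%N.
  by rewrite (size_sub_comp sG' _ mh mh' sh sh') ?se ?natr_neq0 // -subr_eq0.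
have BE : D \Po h = - (d ^+ p + T).
  apply/eqP; rewrite /T /D /d -addr_eq0 expXpB !comp_polyB !comp_Xn_poly fE fE'.
  by apply/eqP; ring.
have sB : size (D \Po h) = size (d ^+ p + T) by rewrite BE size_polyN.
have not_dvd_e (c : nat) : (c * p)%N <> (l * p + e)%N.
  move/(congr1 (modn^~ p)); rewrite modnMl modnMDl modn_small // => e0.
  by move: e_gt0; rewrite -e0.
have D_neq0 : D != 0.
  apply/eqP => D0; move/eqP: BE; rewrite D0 comp_poly0 eq_sym oppr_eq0 addr_eq0.
  move/eqP/(congr1 (fun P : {poly F} => size P)).
  rewrite size_polyN sA sT addnS => -[]; exact: not_dvd_e.
have sD : (size D <= l.+2)%N.
  have -> : D = (g - 'X^p) - (g' - 'X^p) by rewrite /D; ring.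
  by rewrite (leq_trans (size_polyD _ _)) // size_polyN sG sG' maxnn.
have [c sc] : exists c, size D = c.+1.
  by exists (size D).-1; rewrite prednK ?size_poly_gt0.
move: sB; rewrite (size_comp_polyS h_gt1 sc) sh /=.
(* For [e <= l] the term [T] dominates and its degree [l * p + e] would be a multiple of [p]. For
   [l < e] the term [d ^+ p] dominates, so [D] has degree [e], and [sD] leaves only [e = l.+1]. *)
have [le_el|lt_le] := leqP e l.
  rewrite addrC size_polyDl ?sT ?sA => [E|]; last first.
    by rewrite -addSnnS -addn1 leq_add // ltnS leq_mul2r le_el orbT.
  by case: (not_dvd_e c); lia.
rewrite size_polyDl ?sT ?sA => [[/eqP]|].
  rewrite eqn_pmul2r // => /eqP ce; move: sD; rewrite sc se ce.
  by move=> ?; have -> : e = l.+1 by lia.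
by rewrite ltnS; nia.
Qed.

(** * Vanishing derivative: the Frobenius collisions *)

Lemma deriv_eq0_Xp g : monic_original_deg p g -> g^`() = 0 -> g = 'X^p.
Proof.
move=> dg; rewrite deriv_subXp => g'_eq0; apply/eqP; rewrite -subr_eq0.
apply/eqP/polyP => -[|j]; rewrite coef0.
  by case: dg => _ + _; rewrite coef_subXp ?prime_gt0.
case: dg => /monicP mg _ sg; have [j_ltp|] := ltnP j.+1 p.
  have /eqP : (g - 'X^p)^`()`_j = 0 by rewrite g'_eq0 coef0.
  by rewrite coef_deriv -mulr_natl mulf_eq0 (negPf (natr_neq0 _)) // => /eqP.
rewrite coefB coefXn leq_eqVlt => /predU1P[<-|p_ltj].
  by move: mg; rewrite lead_coefE sg /= eqxx => ->; rewrite subrr.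
by rewrite nth_default ?sg // gtn_eqF // subrr.
Qed.

Lemma expXp_inj h h' : h ^+ p = h' ^+ p -> h = h'.
Proof.
move/eqP; rewrite -subr_eq0 -expXpB expf_eq0 subr_eq0.
by case/andP=> _ /eqP.
Qed.

Lemma compXp_inj (g g' : {poly F}) : g \Po 'X^p = g' \Po 'X^p -> g = g'.
Proof.
have Xp_gt1 : (1 < size ('X^p : {poly F}))%N.
  by rewrite size_polyXn ltnS prime_gt0.
move=> E; apply/eqP.
by rewrite -subr_eq0 -(comp_poly_eq0 _ Xp_gt1) comp_polyB E subrr.
Qed.

(** Every pair has a component ['X^p], and two pairs with ['X^p] in the same position coincide. Two
    distinct pairs therefore supply one of each kind, and these exhaust [C]. *)
Lemma deriv0_frobenius i (C : {fset {poly F} * {poly F}}) f :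
  (2 <= i)%N -> is_collision p i C f -> f^`() = 0 ->
  is_frobenius_collision p C.
Proof.
move=> i_ge2 [cardC decC] f'_eq0.
have [|x [y [xC yC neq_xy]]] := @cardfs_gt1_neq _ C; first by rewrite cardC.
have XpP g h : (g, h) \in C -> g = 'X^p \/ h = 'X^p.
  move=> /decC[dg dh fE]; move/eqP: f'_eq0; rewrite -fE deriv_comp mulf_eq0.
  rewrite comp_poly_eq0; last by case: dh => _ _ ->; rewrite ltnS prime_gt0.
  by case/orP=> /eqP; [left | right]; apply: deriv_eq0_Xp.
have uniq2 h h' : ('X^p, h) \in C -> ('X^p, h') \in C -> h = h'.
  move=> /decC[_ _ E] /decC[_ _]; rewrite -E !comp_Xn_poly => /expXp_inj.
  by move->.
have uniq1 g g' : (g, 'X^p) \in C -> (g', 'X^p) \in C -> g = g'.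
  by move=> /decC[_ _ E] /decC[_ _]; rewrite -E => /compXp_inj ->.
have [h hC h_neq] : exists2 h, ('X^p, h) \in C & h <> 'X^p.
  case: x y xC yC neq_xy => [g h] [g' h'] xC yC neq_xy.
  have [hE|/eqP h_neq] := eqVneq h 'X^p; last first.
    by exists h => //; case: (XpP _ _ xC) => // <-.
  have [hE'|/eqP h_neq] := eqVneq h' 'X^p; last first.
    by exists h' => //; case: (XpP _ _ yC) => // <-.
  by move: neq_xy; rewrite hE hE' in xC yC *; rewrite (uniq1 _ _ xC yC) eqxx.
have [g gC g_neq] : exists2 g, (g, 'X^p) \in C & g <> 'X^p.
  case: x y xC yC neq_xy => [g h'] [g' h''] xC yC neq_xy.
  have [gE|/eqP g_neq] := eqVneq g 'X^p; last first.
    by exists g => //; case: (XpP _ _ xC) => // <-.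
  have [gE'|/eqP g_neq] := eqVneq g' 'X^p; last first.
    by exists g' => //; case: (XpP _ _ yC) => // <-.
  by move: neq_xy; rewrite gE gE' in xC yC *; rewrite (uniq2 _ _ xC yC) eqxx.
(* Both [g \Po 'X^p] and [h ^+ p] equal [f], and ['X^p] cancels on the right. *)
have gE : g = sigma p h.
  apply: compXp_inj; rewrite -expXp_comp -(comp_Xn_poly h).
  by have [_ _ ->] := decC _ _ gC; have [_ _ ->] := decC _ _ hC.
exists h; split=> //; first by case: (decC _ _ hC).
rewrite -gE; apply/fsetP => -[g' h']; rewrite !inE.
apply/idP/orP => [ghC|[/eqP[-> ->]|/eqP[-> ->]]] //.
case: (XpP _ _ ghC) => E; rewrite E in ghC *.
  by left; rewrite (uniq2 _ _ ghC hC).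
by right; rewrite (uniq1 _ _ ghC gC).
Qed.

End CollisionsCharP.

(** * Non-Frobenius collisions *)

Theorem proposition6p7 (F : finFieldType) (p : nat) (charFp : p \in [pchar F])
    (i : nat) (i_ge2 : (2 <= i)%N)
    (C : {fset {poly F} * {poly F}}) (f : {poly F})
    (C_coll : is_collision p i C f) (C_nonfrob : ~ is_frobenius_collision p C) :
  exists k : nat, (1 <= k < p)%N /\
    let a := - f`_(k * p) in
    let b := (k%:R)^-1 * f`_(k * p - p + k) in
    (forall g h : {poly F}, (g, h) \in C ->
      [/\ (* (i) *)
          deg2 g = Some k /\ deg2 h = Some k,
          (* (ii) *)
          forall g' h' : {poly F}, (g', h') \in C -> (g, h) <> (g', h') ->
            g`_k <> g'`_k /\ h`_k <> h'`_k
        & (* (iii) *)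
          [/\ b * h`_k <> 0,
              h`_k ^+ p.+1 + a * h`_k + b = 0,
              g`_k = - a - h`_k ^+ p
            & - a - h`_k ^+ p = b * (h`_k)^-1]])
    /\ (* (iv) *) (i <= p.+1)%N.
Proof.
have f'_neq0 : f^`() != 0.
  apply/eqP => f'_eq0; apply: C_nonfrob.
  exact: (deriv0_frobenius charFp i_ge2 C_coll).
case: C_coll => cardC decC.
have [|[g0 h0] [[g1 h1] [xC yC neq_xy]]] := @cardfs_gt1_neq _ C.
  by rewrite cardC.
have dataC g h : (g, h) \in C -> exists l m, [/\ size (g - 'X^p) = l.+2,
    (l.+1 < p)%N, size (h - 'X^p) = m.+2 & (m.+1 < p)%N].
  move=> /decC[dg dh fE]; move: f'_neq0.
  rewrite -fE deriv_comp mulf_eq0 negb_or => /andP[g'h_neq0 h'_neq0].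
  have g'_neq0 : g^`() != 0.
    by apply: contra g'h_neq0 => /eqP ->; rewrite comp_poly0.
  have [l sG l_ltp] := size_subXp charFp dg g'_neq0.
  by have [m sH m_ltp] := size_subXp charFp dh h'_neq0; exists l, m.
have [l [m [sG0 l_ltp sH0 m_ltp]]] := dataC _ _ xC.
have sizeC g h : (g, h) \in C ->
    size (g - 'X^p) = l.+2 /\ size (h - 'X^p) = m.+2.
  move=> ghC; have [l' [m' [sG l'_ltp sH m'_ltp]]] := dataC _ _ ghC.
  have [dg0 dh0 fE0] := decC _ _ xC; have [dg dh fE] := decC _ _ ghC.
  have := size_deriv_decomp charFp dh0 fE0 sG0 l_ltp sH0 m_ltp.
  rewrite (size_deriv_decomp charFp dh fE sG l'_ltp sH m'_ltp) => -[E].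
  (* Both [m] and [m'] are the remainder of the degree of the derivative modulo [p]. *)
  have Em : m' = m.
    by move/(congr1 (modn^~ p)): (E); rewrite !modnMDl !modn_small // ltnW.
  have El : l' = l.
    by move: E; rewrite Em => /addIn/eqP; rewrite eqn_pmul2r; [move/eqP | lia].
  by rewrite sG sH El Em.
have subC g h g' h' : (g, h) \in C -> (g', h') \in C -> (g, h) != (g', h') ->
    size (g - g') = l.+2 /\ size (h - h') = l.+2.
  move=> ghC ghC' neq; have [dg dh fE] := decC _ _ ghC.
  have [_ dh' fE'] := decC _ _ ghC'.
  have [[sG _] [sG' _]] := (sizeC _ _ ghC, sizeC _ _ ghC').
  exact: (size_sub_decomp charFp dh dh' fE fE' neq sG sG' l_ltp).
have coef_neq (P Q : {poly F}) n : size (P - Q) = n.+1 -> P`_n <> Q`_n.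
  move=> sPQ E; have := lead_coef_eq0 (P - Q).
  by rewrite lead_coefE sPQ coefB E subrr eqxx -size_poly_eq0 sPQ.
have {m_ltp} ml : m = l.
  have [sg sh] := subC _ _ _ _ xC yC neq_xy.
  have [sG1 sH1] := sizeC _ _ yC.
  have le_lm : (l <= m)%N.
    have := size_polyD (h0 - 'X^p) (- (h1 - 'X^p)).
    rewrite size_polyN sH0 sH1 maxnn opprB addrA subrK sh; lia.
  apply/eqP; move: le_lm; rewrite leq_eqVlt eq_sym => /predU1P[->|lt_lm] //.
  (* Index [m.+1] lies above the degree [l.+1] of [h0 - h1]. *)
  have hm : h0`_m.+1 = h1`_m.+1.
    by apply/eqP; rewrite -subr_eq0 -coefB nth_default ?sh ?eqxx.
  have [dg0 dh0 fE0] := decC _ _ xC; have [dg1 dh1 fE1] := decC _ _ yC.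
  have hm_neq0 : h0`_m.+1 != 0 by apply: (coef2_neq0 (p := p) sH0).
  have := coef_deriv_decomp charFp dh0 fE0 sG0 l_ltp sH0 m_ltp.
  rewrite (coef_deriv_decomp charFp dh1 fE1 sG1 l_ltp sH1 m_ltp) -hm => E.
  case: (coef_neq _ _ _ sg); apply: (mulfI (x := l.+1%:R)).
    by rewrite -(dvdn_pcharf charFp) gtnNdvd.
  exact: (mulIf hm_neq0 (esym E)).
rewrite {m}ml in sH0 sizeC.
exists l.+1; split; first exact: l_ltp.
move=> a b.
have p_gt0 : (0 < p)%N by lia.
have l_neq0 : l.+1%:R != 0 :> F by rewrite -(dvdn_pcharf charFp) gtnNdvd.
(* The relations [g_k + h_k^p = -a] and [g_k h_k = b] carry all of (iii): eliminating [g_k] yields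
   the equation for [h_k]. *)
have abC g h : (g, h) \in C -> [/\ g`_l.+1 != 0, h`_l.+1 != 0,
    g`_l.+1 + h`_l.+1 ^+ p = - a & b = g`_l.+1 * h`_l.+1].
  move=> ghC; have [dg dh fE] := decC _ _ ghC; have [sG sH] := sizeC _ _ ghC.
  split; first exact: (coef2_neq0 sG l_ltp).
  - exact: (coef2_neq0 sH l_ltp).
  - by rewrite opprK (coef_lead_decomp charFp dh fE sG l_ltp) addrC.
  (* With [k = l.+1], the index [k * p - p + k] becomes [l * p + l.+1]; the natural subtraction does
     not truncate. *)
  rewrite /b mulSn addKn (coef_deriv_decomp charFp dh fE sG l_ltp sH l_ltp).
  by rewrite -mulrA mulKf.
have rootC g h : (g, h) \in C -> h`_l.+1 ^+ p.+1 + a * h`_l.+1 + b = 0.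
  by move=> /abC[_ _ aE ->]; rewrite -[a]opprK -aE exprS; ring.
split=> [g h ghC|].
  have [dg dh fE] := decC _ _ ghC; have [sG sH] := sizeC _ _ ghC.
  have [g_neq0 h_neq0 aE bE] := abC _ _ ghC.
  split=> [|g' h' ghC' /eqP neq|].
  - by rewrite (deg2_subXp dg sG) (deg2_subXp dh sH).
  - by have [/coef_neq ? /coef_neq ?] := subC _ _ _ _ ghC ghC' neq.
  split; first by apply/eqP; rewrite bE !mulf_neq0.
  - exact: rootC ghC.
  - by rewrite -aE addrK.
  by rewrite -aE addrK bE mulfK.
(* The coefficients [h_k] are roots of this polynomial of degree [p.+1], and they are pairwise
   distinct by [subC], so there are at most [p.+1] pairs. *)
pose P : {poly F} := 'X^(p.+1) + (a *: 'X + b%:P).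
have sP : size P = p.+2.
  rewrite size_polyDl size_polyXn // (leq_ltn_trans (size_polyD _ _)) //.
  rewrite gtn_max (leq_ltn_trans (size_scale_leq _ _)) ?size_polyX //.
  by rewrite (leq_ltn_trans (size_polyC_leq1 _)).
pose hk (x : {poly F} * {poly F}) := x.2`_l.+1.
have <- : size (map hk (enum_fset C)) = i by rewrite size_map.
rewrite -ltnS -sP.
apply: max_poly_roots; first by rewrite -size_poly_gt0 sP.
  apply/allP => c /mapP[[g h] /= ghC ->].
  by rewrite rootE /P /hk !hornerE /= (rootC _ _ ghC).
rewrite map_inj_in_uniq ?fset_uniq // => -[g h] [g' h'] ghC ghC' /= E.
apply/eqP; apply/negPn/negP => neq.
by have [_ /coef_neq] := subC _ _ _ _ ghC ghC' neq; apply.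
Qed.
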